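(* For $\alpha\in\mathbb{C}$ let $\mathcal{W}_\alpha=\{W_{a,b}\}_{a,b\in\mathbb{F}_2}$ be the two-sender classical-quantum multiple access channel with coherent-state outputs $W_{a,b}=|((-1)^a+(-1)^b)\alpha\rangle\langle((-1)^a+(-1)^b)\alpha|$, and let $C_{\mathrm{COMP}}(\mathcal{W}_\alpha)$ be its computation rate. Then $$\lim_{|\alpha|\to\infty}C_{\mathrm{COMP}}(\mathcal{W}_\alpha)=\log 2,$$ that is, the computation rate converges to $1$ bit per channel use.
   Context: **Notation.** $\log$ is to any fixed base (rates are measured in the corresponding unit; base 2 gives bits). The coherent state is $|\beta\rangle=e^{-|\beta|^2/2}\sum_{m\ge0}\frac{\beta^m}{\sqrt{m!}}|m\rangle$ in the Fock space $\mathcal{H}_Y$ with orthonormal number basis $\{|m\rangle\}_{m\ge0}$. $\oplus$ is (componentwise) addition in $\mathbb{F}_2$. **Channel.** For inputs $a^n,b^n\in\mathbb{F}_2^n$ of the two senders the receiver obtains $W_{a_1,b_1}\otimes\cdots\otimes W_{a_n,b_n}$ on $\mathcal{H}_Y^{\otimes n}$. **Computation rate.** A COMP code of blocklength $n$ and rate $R$ consists of a common message set $\mathbb{F}_2^\ell$ with $\frac{\ell}{n}\log2\cong R$ (i.e. $\frac{\ell}{n}\log 2\to R$ along a sequence of codes), two encoders $\phi_A^n,\phi_B^n:\mathbb{F}_2^\ell\to\mathbb{F}_2^n$, and a decoder, which is a POVM on $\mathcal{H}_Y^{\otimes n}$ with outcomes in $\mathbb{F}_2^\ell$. The messages $M_A,M_B$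 are independent and uniform on $\mathbb{F}_2^\ell$; the error probability is the probability that the decoder's outcome on the state received for inputs $\phi_A^n(M_A),\phi_B^n(M_B)$ differs from $M_A\oplus M_B$. $R$ is achievable if some sequence of such codes has error probability tending to $0$ as $n\to\infty$. $C_{\mathrm{COMP}}(\mathcal{W}_\alpha)$ is the supremum of achievable rates. *)

(* Defs.v *)
(* The complex numbers are R[i], for R : realType. *)
From HB Require Import structures.
From mathcomp Require Import all_boot all_order all_algebra.
From mathcomp Require Import all_classical all_reals all_analysis.
From mathcomp Require Import complex ring.

Set Implicit Arguments.
Unset Strict Implicit.
Unset Printing Implicit Defensive.

Import Order.TTheory GRing.Theory Num.Theory.
Import numFieldNormedType.Exports.

Local Open Scope classical_set_scope.
Local Open Scope ring_scope.
Local Open Scope complex_scope.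

(* The library norm `|z| on R[i] is R[i]-valued; cabs z is the same number,
   as an element of R. *)
Definition cabs (R : realType) (z : R[i]) : R := complex.Re `|z|.

Lemma cabsE (R : realType) (z : R[i]) : `|z| = (cabs z)%:C.
Proof. by rewrite /cabs normc_def. Qed.

Lemma cabs_ge0 (R : realType) (z : R[i]) : 0 <= cabs z.
Proof. by rewrite -lecR -cabsE normr_ge0. Qed.

Lemma cabsM (R : realType) (x y : R[i]) : cabs (x * y) = cabs x * cabs y.
Proof. by apply: complexI; rewrite rmorphM/= -!cabsE normrM. Qed.

Lemma cabsD (R : realType) (x y : R[i]) : cabs (x + y) <= cabs x + cabs y.
Proof. by rewrite -lecR rmorphD/= -!cabsE ler_normD. Qed.

Lemma cabs0 (R : realType) : cabs (0 : R[i]) = 0.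
Proof. by rewrite /cabs normr0. Qed.

Lemma cabs1 (R : realType) : cabs (1 : R[i]) = 1.
Proof. by rewrite /cabs normr1. Qed.

Lemma cabsX (R : realType) (z : R[i]) n : cabs (z ^+ n) = cabs z ^+ n.
Proof. by elim: n => [|n IH]; rewrite ?expr0 ?cabs1// !exprS cabsM IH. Qed.

Lemma cabsR (R : realType) (x : R) : cabs x%:C = `|x|.
Proof. by rewrite /cabs normc_def/= expr0n/= addr0 sqrtr_sqr. Qed.

(* Unordered sums of absolutely summable families: the library's \esum is only
   meaningful for nonnegative terms. *)
Definition rsum (R : realType) (I : choiceType) (f : I -> R) : R :=
  fine (\esum_(i in [set: I]) (Num.max (f i) 0)%:E
        - \esum_(i in [set: I]) (Num.max (- f i) 0)%:E)%E.

Definition csum (R : realType) (I : choiceType) (f : I -> R[i]) : R[i] :=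
  rsum (fun i => complex.Re (f i)) +i* rsum (fun i => complex.Im (f i)).

(* The Hilbert space l^2(I), as an R[i]-module. *)
Definition ell2_pred (R : realType) (I : choiceType) : {pred I -> R[i]} :=
  fun f => `[< (\esum_(i in [set: I]) ((cabs (f i)) ^+ 2)%:E < +oo)%E >].

Lemma esum_lty_scale (R : realType) (I : choiceType) (c : R) (g : I -> R) :
  0 <= c -> (forall i, 0 <= g i) ->
  (\esum_(i in [set: I]) (g i)%:E < +oo)%E ->
  (\esum_(i in [set: I]) (c * g i)%:E < +oo)%E.
Proof.
move=> c0 g0 gfin.
have g0' : (0 <= \esum_(i in [set: I]) (g i)%:E)%E.
  by apply: esum_ge0 => i _; rewrite lee_fin.
apply: (@le_lt_trans _ _ (c%:E * \esum_(i in [set: I]) (g i)%:E)%E); last first.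
  rewrite -(@fineK _ (\esum_(i in [set: I]) (g i)%:E)%E) ?ge0_fin_numE//.
  by rewrite -EFinM ltry.
apply: ge_ereal_sup => _ [/= F FT <-].
under eq_fsbigr do rewrite EFinM.
rewrite -ge0_mule_fsumr; last by move=> i; rewrite lee_fin.
apply: lee_pmul => //; first by apply: fsume_ge0 => i _; rewrite lee_fin.
by apply: ereal_sup_ubound; exists F.
Qed.

Lemma ell2_pred_submod (R : realType) (I : choiceType) :
  submod_closed (@ell2_pred R I).
Proof.
split.
  apply/asboolP; rewrite esum1 ?ltry// => i _.
  by rewrite cabs0 expr0n.
move=> a f g /asboolP fP /asboolP gP; apply/asboolP.
have f2 i : 0 <= cabs (f i) ^+ 2 by rewrite exprn_ge0// cabs_ge0.
have g2 i : 0 <= cabs (g i) ^+ 2 by rewrite exprn_ge0// cabs_ge0.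
have c0 : 0 <= 2 * cabs a ^+ 2 by rewrite mulr_ge0// exprn_ge0// cabs_ge0.
have fP' := esum_lty_scale c0 f2 fP.
have gP' := esum_lty_scale (ler0n R 2) g2 gP.
apply: (@le_lt_trans _ _ (\esum_(i in [set: I])
   ((2 * cabs a ^+ 2 * cabs (f i) ^+ 2)%:E + (2 * cabs (g i) ^+ 2)%:E))%E).
  apply: le_esum => i _; rewrite -EFinD lee_fin.
  have /ler_wpM2l := cabsD (a * f i) (g i).
  set x := cabs _; set y := cabs (f i); set z := cabs (g i) => H.
  have xle : x <= cabs a * y + z by rewrite /x /y /z -cabsM cabsD.
  have x0 : 0 <= x by exact: cabs_ge0.
  apply: (@le_trans _ _ ((cabs a * y + z) ^+ 2)).
    by rewrite lerXn2r// nnegrE ?(le_trans x0).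
  rewrite -subr_ge0 [leRHS](_ : _ = (cabs a * y - z) ^+ 2) ?sqr_ge0//.
  by rewrite !expr2; ring.
rewrite esumD; last 2 first.
  by move=> i _; rewrite lee_fin mulr_ge0.
  by move=> i _; rewrite lee_fin mulr_ge0.
by rewrite lte_add_pinfty.
Qed.

HB.instance Definition _ (R : realType) (I : choiceType) :=
  GRing.isSubmodClosed.Build R[i] (I -> R[i]) (@ell2_pred R I)
    (@ell2_pred_submod R I).

Record ell2 (R : realType) (I : choiceType) : Type :=
  Ell2 { ell2_fun :> I -> R[i]; ell2_funP : ell2_fun \in @ell2_pred R I }.

HB.instance Definition _ (R : realType) (I : choiceType) :=
  [isSub for @ell2_fun R I].
HB.instance Definition _ (R : realType) (I : choiceType) :=
  [Choice of ell2 R I by <:].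
HB.instance Definition _ (R : realType) (I : choiceType) :=
  [SubChoice_isSubLmodule of ell2 R I by <:].

(* Antilinear in the first argument. *)
Definition inner (R : realType) (I : choiceType) (u v : ell2 R I) : R[i] :=
  csum (fun i => (u i)^* * v i).

Lemma delta_ell2 (R : realType) (I : choiceType) (k : I) :
  (fun i => (i == k)%:R) \in @ell2_pred R I.
Proof.
apply/asboolP.
rewrite (_ : (fun _ => _) = fun i => if i \in [set k] then 1%:E else 0%E).
  by rewrite -esum_mkcond esum_set1 ?ltry ?lee_fin// ler01.
apply/funext => i; case: (eqVneq i k) => [->|ik].
  by rewrite mem_set// cabs1 expr1n.
by rewrite memNset ?cabs0 ?expr0n//= => /eqP; exact/negP.
Qed.

Definition basis_vec (R : realType) (I : choiceType) (k : I) : ell2 R I :=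
  Ell2 (delta_ell2 R k).

Definition operator (R : realType) (I : choiceType) := ell2 R I -> ell2 R I.

(* |u><v| *)
Definition ketbra (R : realType) (I : choiceType) (u v : ell2 R I) :
  operator R I := fun w => inner v w *: u.

Definition mx_of_op (R : realType) (I : choiceType) (A : operator R I) :
  I -> I -> R[i] := fun k l => inner (basis_vec R k) (A (basis_vec R l)).

(* The operator with matrix K in the basis basis_vec. For the matrix of a
   bounded operator all sums are absolutely convergent and the image of an
   l^2 vector is l^2, so that the default value 0 of insubd is never used. *)
Definition op_of_mx (R : realType) (I : choiceType) (K : I -> I -> R[i]) :
  operator R I := fun u => insubd 0 (fun k => csum (fun l => K k l * u l)).

Definition trace (R : realType) (I : choiceType) (A : operator R I) : R[i] :=
  csum (fun k => mx_of_op A k k).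

(* Fock space, with its number basis, and its n-fold tensor power
   l^2(nat)^{(x) n} = l^2(nat^n), with basis |k_1> (x) ... (x) |k_n>. *)
Definition fock (R : realType) := ell2 R nat.
Definition modes (n : nat) := {ffun 'I_n -> nat}.

(* A_1 (x) ... (x) A_n, whose matrix in the product basis has entries
   prod_i <k_i| A_i |l_i>. *)
Definition tensor_op (R : realType) (n : nat) (A : 'I_n -> operator R nat) :
  operator R (modes n) :=
  op_of_mx (fun k l : modes n => \prod_i mx_of_op (A i) (k i) (l i)).

(* Amplitudes in the number basis. *)
Definition coherent_fun (R : realType) (beta : R[i]) (m : nat) : R[i] :=
  (expR (- (cabs beta ^+ 2 / 2)))%:C * (beta ^+ m / (Num.sqrt m`!%:R)%:C).

Lemma coherent_ell2 (R : realType) (beta : R[i]) :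
  coherent_fun beta \in @ell2_pred R nat.
Proof.
apply/asboolP; set c := expR (- (cabs beta ^+ 2 / 2)).
pose x := cabs beta ^+ 2; have x0 : 0 <= x by rewrite exprn_ge0// cabs_ge0.
have e0 m : 0 <= exp_coeff x m by exact: exp_coeff_ge0.
rewrite (_ : (fun _ => _) = fun m => (c ^+ 2 * exp_coeff x m)%:E); last first.
  apply/funext => m; congr EFin; rewrite /coherent_fun -/c.
  rewrite !cabsM -fmorphV !cabsR cabsX !exprMn.
  rewrite (ger0_norm (expR_ge0 _)) ger0_norm ?invr_ge0 ?sqrtr_ge0//.
  by rewrite exprVn sqr_sqrtr// /exp_coeff /= /x -!exprM mulnC.
apply: esum_lty_scale => //; first exact: sqr_ge0.
rewrite -nneseries_esumT; last by move=> m; rewrite lee_fin.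
have -> : (\sum_(0 <= i <oo) (exp_coeff x i)%:E = (expR x)%:E)%E; last exact: ltry.
rewrite /expR -EFin_lim; last exact: is_cvg_series_exp_coeff.
by congr (limn _); apply/funext => n /=; rewrite sumEFin.
Qed.

Definition coherent (R : realType) (beta : R[i]) : fock R :=
  Ell2 (coherent_ell2 beta).

Record povm (R : realType) (M : finType) (I : choiceType) := Povm {
  povm_op :> M -> {linear ell2 R I -> ell2 R I};
  povm_bounded : forall m, exists c : R, forall u,
    cabs (inner (povm_op m u) (povm_op m u)) <= c * cabs (inner u u);
  povm_ge0 : forall m u, 0 <= inner u (povm_op m u);
  povm_sum : forall u, \sum_m povm_op m u = u }.

(* Born rule: probability of outcome m on the state rho. *)
Definition outcome_prob (R : realType) (M : finType) (I : choiceType)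
  (E : povm R M I) (rho : operator R I) (m : M) : R :=
  complex.Re (trace (E m \o rho)).

(* Two-sender classical-quantum channels with input alphabets F_2 and output
   system the Fock space. *)
Definition cq_mac (R : realType) := 'F_2 -> 'F_2 -> operator R nat.

Definition mac_output (R : realType) (W : cq_mac R) (n : nat)
  (a b : 'rV['F_2]_n) : operator R (modes n) :=
  tensor_op (fun i => W (a 0 i) (b 0 i)).

Record comp_code (R : realType) (n l : nat) := CompCode {
  encA : 'rV['F_2]_l -> 'rV['F_2]_n;
  encB : 'rV['F_2]_l -> 'rV['F_2]_n;
  decoder : povm R 'rV['F_2]_l (modes n) }.

Definition comp_error (R : realType) (W : cq_mac R) (n l : nat)
  (c : comp_code R n l) : R :=
  (#|{: 'rV['F_2]_l}|%:R ^+ 2)^-1 *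
  \sum_(mA : 'rV['F_2]_l) \sum_(mB : 'rV['F_2]_l)
    \sum_(m | m != mA + mB)
      outcome_prob (decoder c) (mac_output W (encA c mA) (encB c mB)) m.

Definition logb (R : realType) (base x : R) : R := ln x / ln base.

(* One code for each blocklength n; the value of l 0 / 0 does not affect the
   limit. *)
Definition comp_achievable (R : realType) (base : R) (W : cq_mac R) (r : R) :=
  exists (l : nat -> nat) (c : forall n, comp_code R n (l n)),
    ((l n)%:R / n%:R * logb base 2 @[n --> \oo] --> r) /\
    (comp_error W (c n) @[n --> \oo] --> (0 : R)).

(* Supremum taken in the extended reals, hence without any convention on empty
   or unbounded sets. *)
Definition comp_rate (R : realType) (base : R) (W : cq_mac R) : \bar R :=
  ereal_sup [set r%:E | r in [set r | comp_achievable base W r]].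

Definition coherent_mac (R : realType) (alpha : R[i]) : cq_mac R :=
  fun a b => let psi := coherent (((-1) ^+ a + (-1) ^+ b) * alpha) in
             ketbra psi psi.

(* The filter |alpha| -> +oo on the complex plane. *)
Definition cabs_pinfty (R : realType) : set_system R[i] :=
  filter_from [set: R] (fun M => [set z | M < cabs z]).

Arguments cabs_pinfty : clear implicits.

Global Instance cabs_pinfty_proper (R : realType) :
  ProperFilter (cabs_pinfty R).
Proof.
apply: filter_from_proper.
  apply: filter_from_filter; first by exists 0.
  move=> M N _ _; exists (Num.max M N) => // z /=.
  by rewrite gt_max => /andP[].
move=> M _; exists (`|M| + 1)%:C => /=.
rewrite cabsR ger0_norm ?addr_ge0//.
by rewrite (le_lt_trans (ler_norm M))// ltrDl.
Qed.

(* Main.v *)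
(* Converse: for a fixed message of the second sender, the 2^l messages of the
   first one must be told apart through at most 2^n channel inputs, so that the
   error probability is at least 1 - 2^(n-l), and l <= n as soon as it is below
   1/2.

   Achievability: both senders use the same linear code, and the receiver
   counts the photons of each mode, reading the bit 1 off the vacuum and 0 off
   any other outcome. The output vanishes when a + b = 1 and has intensity
   4|alpha|^2 when a + b = 0, so the codeword of mA + mB is received through a
   Z-channel whose flip probability eps = exp(-4|alpha|^2) tends to 0. A linear
   code of rate close to 1 and minimum distance > 2t, with t proportional to n,
   exists by the Gilbert-Varshamov argument; the probability of more than t flips
   is at most 2^n eps^t, which tends to 0 with n once eps is small enough. *)
From HB Require Import structures.
Require Import Defs.
From mathcomp Require Import all_boot all_order all_algebra.
From mathcomp Require Import all_classical all_reals all_analysis.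
From mathcomp Require Import complex ring lra zify.
Import Order.TTheory GRing.Theory Num.Theory.
Import numFieldNormedType.Exports.

Set Implicit Arguments.
Unset Strict Implicit.
Unset Printing Implicit Defensive.

Local Open Scope classical_set_scope.
Local Open Scope ring_scope.
Local Open Scope complex_scope.

(** * Signed sums and the inner product *)

(** Any summable nonnegative [g] and [h] may replace the positive and negative parts in the
    definition of [rsum]. *)
Lemma rsumB (R : realType) (I : choiceType) (g h : I -> R) :
  (forall i, 0 <= g i) -> (forall i, 0 <= h i) ->
  (\esum_(i in [set: I]) (g i)%:E < +oo)%E ->
  (\esum_(i in [set: I]) (h i)%:E < +oo)%E ->
  rsum (fun i => g i - h i) =
    fine (\esum_(i in [set: I]) (g i)%:E) - fine (\esum_(i in [set: I]) (h i)%:E).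
Proof.
move=> g0 h0 gfin hfin.
have sg : summable [set: I] (fun i => (g i)%:E).
  rewrite /summable; under eq_esum do rewrite gee0_abs ?lee_fin//.
  exact: gfin.
have sh : summable [set: I] (fun i => (h i)%:E).
  rewrite /summable; under eq_esum do rewrite gee0_abs ?lee_fin//.
  exact: hfin.
have /(_ _ _)/= := esumB sg sh.
move=> /(_ (fun i _ => g0 i) (fun i _ => h0 i)).
rewrite /rsum => H.
rewrite -fineB; last 2 first.
  by rewrite ge0_fin_numE//; apply: esum_ge0 => i _; rewrite lee_fin.
  by rewrite ge0_fin_numE//; apply: esum_ge0 => i _; rewrite lee_fin.
rewrite -[in RHS]H; congr (fine (_ - _)).
  by apply: eq_esum => i _; rewrite funeposE -EFinB -EFin_max.
by apply: eq_esum => i _; rewrite funenegE -EFinB -EFinN -EFin_max.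
Qed.

Lemma le_esum_lty (R : realType) (I : choiceType) (g h : I -> R) :
  (forall i, g i <= h i) -> (\esum_(i in [set: I]) (h i)%:E < +oo)%E ->
  (\esum_(i in [set: I]) (g i)%:E < +oo)%E.
Proof.
by move=> gh; apply: le_lt_trans; apply: le_esum => i _; rewrite lee_fin.
Qed.

Lemma rsum_ge0E (R : realType) (I : choiceType) (f : I -> R) :
  (forall i, 0 <= f i) -> rsum f = fine (\esum_(i in [set: I]) (f i)%:E).
Proof.
move=> f0; rewrite /rsum [X in (_ - X)%E]esum1 ?sube0.
  by congr fine; apply: eq_esum => i _; rewrite max_l.
by move=> i _; rewrite max_r// oppr_le0.
Qed.

Lemma rsum0 (R : realType) (I : choiceType) : rsum (fun _ : I => 0 : R) = 0.
Proof. by rewrite rsum_ge0E// esum1. Qed.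

Lemma rsumD (R : realType) (I : choiceType) (f g : I -> R) :
  (\esum_(i in [set: I]) `|f i|%:E < +oo)%E ->
  (\esum_(i in [set: I]) `|g i|%:E < +oo)%E ->
  rsum (fun i => f i + g i) = rsum f + rsum g.
Proof.
move=> sf sg.
pose p (h : I -> R) i := Num.max (h i) 0; pose q (h : I -> R) i := Num.max (- h i) 0.
have pq h i : h i = p h i - q h i.
  rewrite /p /q; case: (leP (h i) 0) => h0.
    by rewrite max_l ?oppr_ge0//; lra.
  by rewrite max_r ?oppr_le0 ?ltW//; lra.
have p0 h i : 0 <= p h i by rewrite /p le_max lexx orbT.
have q0 h i : 0 <= q h i by rewrite /q le_max lexx orbT.
have ple h i : p h i <= `|h i| by rewrite /p ge_max ler_norm normr_ge0.
have qle h i : q h i <= `|h i| by rewrite /q ge_max -normrN ler_norm normr_ge0.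
have fp := le_esum_lty (ple f) sf; have fq := le_esum_lty (qle f) sf.
have gp := le_esum_lty (ple g) sg; have gq := le_esum_lty (qle g) sg.
have D (u v : I -> R) : (forall i, 0 <= u i) -> (forall i, 0 <= v i) ->
    (\esum_(i in [set: I]) (u i + v i)%:E =
     \esum_(i in [set: I]) (u i)%:E + \esum_(i in [set: I]) (v i)%:E)%E.
  by move=> u0 v0; rewrite -esumD// => i _; rewrite lee_fin.
(* The parts of a sum are not the sums of the parts, but the latter still split [f + g] into two
   nonnegative summable families, which is all that [rsumB] asks. *)
rewrite [X in rsum X](_ : _ = fun i => (p f i + p g i) - (q f i + q g i)); last first.
  by apply/funext => i; rewrite (pq f) (pq g); ring.
rewrite rsumB; last 4 first.
  by move=> i; rewrite addr_ge0.
  by move=> i; rewrite addr_ge0.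
  by rewrite D// lte_add_pinfty.
  by rewrite D// lte_add_pinfty.
have E h : rsum h = rsum (fun i => p h i - q h i).
  by congr rsum; apply/funext => i; rewrite -pq.
rewrite (E f) (E g) !rsumB// !D//.
have fin (u : I -> R) : (forall i, 0 <= u i) ->
   (\esum_(i in [set: I]) (u i)%:E < +oo)%E ->
   (\esum_(i in [set: I]) (u i)%:E)%E \is a fin_num.
  by move=> u0; rewrite ge0_fin_numE//; apply: esum_ge0 => i _; rewrite lee_fin.
by rewrite !fineD ?fin//; ring.
Qed.

Lemma rsum_single (R : realType) (I : choiceType) (k : I) (f : I -> R) :
  (forall i, i != k -> f i = 0) -> rsum f = f k.
Proof.
move=> fk; rewrite /rsum.
have S (g : I -> R) : (forall i, i != k -> g i = 0) -> 0 <= g k ->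
    (\esum_(i in [set: I]) (g i)%:E = (g k)%:E)%E.
  move=> gk gk0; rewrite (esumID [set k]); last first.
    move=> i _; rewrite lee_fin; case: (eqVneq i k) => [->//|ik].
    by rewrite gk.
  rewrite setTI esum_set1 ?lee_fin// esum1 ?adde0// => i [_ /eqP] ik.
  by rewrite gk.
rewrite (S (fun i => Num.max (f i) 0)); last 2 first.
  by move=> i ik; rewrite fk// maxxx.
  by rewrite le_max lexx orbT.
rewrite (S (fun i => Num.max (- f i) 0)); last 2 first.
  by move=> i ik; rewrite fk// oppr0 maxxx.
  by rewrite le_max lexx orbT.
rewrite -EFinB /=; case: (leP (f k) 0) => h0.
  by rewrite max_l ?oppr_ge0//; lra.
by rewrite max_r ?oppr_le0 ?ltW//; lra.
Qed.

Lemma csum_single (R : realType) (I : choiceType) (k : I) (f : I -> R[i]) :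
  (forall i, i != k -> f i = 0) -> csum f = f k.
Proof.
move=> fk; rewrite /csum !(rsum_single (k := k)); first by case: (f k).
  by move=> i ik; rewrite fk.
by move=> i ik; rewrite fk.
Qed.

Lemma inner_basis_vec (R : realType) (I : choiceType) (k : I) (u : ell2 R I) :
  inner (basis_vec R k) u = u k.
Proof.
rewrite /inner (csum_single (k := k)) /= => [|i /negPf->]; last first.
  by rewrite rmorph0 mul0r.
by rewrite eqxx rmorph1 mul1r.
Qed.

Lemma inner_basis_vecr (R : realType) (I : choiceType) (k : I) (u : ell2 R I) :
  inner u (basis_vec R k) = (u k)^*.
Proof.
rewrite /inner (csum_single (k := k)) /= => [|i /negPf->]; last by rewrite mulr0.
by rewrite eqxx mulr1.
Qed.

Lemma ell2_scale (R : realType) (I : choiceType) (a : R[i]) (u : ell2 R I) k :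
  (a *: u) k = a * u k.
Proof. by []. Qed.

Lemma ell2_sum (R : realType) (I : choiceType) (J : finType) (P : pred J)
    (F : J -> ell2 R I) k : (\sum_(j | P j) F j) k = \sum_(j | P j) F j k.
Proof. by elim/big_rec2: _ => // j x y _ <-. Qed.

Lemma normRe (R : realType) (z : R[i]) : `|complex.Re z| <= cabs z.
Proof.
case: z => a b; rewrite /cabs normc_def /= -sqrtr_sqr.
by rewrite ler_wsqrtr// lerDl sqr_ge0.
Qed.

(** Termwise, the modulus is at most [|u i| * |v i| <= |u i|^2 + |v i|^2]. Real parts suffice below
    because the Born rule takes the real part of a trace. *)
Lemma esum_inner_lty (R : realType) (I : choiceType) (u v : ell2 R I) :
  (\esum_(i in [set: I]) `|complex.Re ((u i)^* * v i)|%:E < +oo)%E.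
Proof.
apply: (@le_esum_lty _ _ _ (fun i => cabs (u i) ^+ 2 + cabs (v i) ^+ 2)).
  move=> i; apply: (le_trans (normRe _)); rewrite cabsM.
  have -> : cabs (u i)^* = cabs (u i).
    by case: (u i) => a b; rewrite /cabs !normc_def /= sqrrN.
  have := cabs_ge0 (u i); have := cabs_ge0 (v i); nra.
have ufin := ell2_funP u; have vfin := ell2_funP v.
move/asboolP: ufin => ufin; move/asboolP: vfin => vfin.
rewrite (_ : (\esum_(_ in _) _)%E =
   (\esum_(i in [set: I]) ((cabs (u i)) ^+ 2)%:E +
    \esum_(i in [set: I]) ((cabs (v i)) ^+ 2)%:E)%E) ?lte_add_pinfty//.
by rewrite -esumD// => i _; rewrite lee_fin sqr_ge0.
Qed.

Lemma Re_innerD (R : realType) (I : choiceType) (u v w : ell2 R I) :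
  complex.Re (inner u (v + w)) = complex.Re (inner u v) + complex.Re (inner u w).
Proof.
rewrite /inner /csum /= -rsumD; try exact: esum_inner_lty.
by congr rsum; apply/funext => i; rewrite -raddfD -mulrDr.
Qed.

Lemma Re_inner_sum (R : realType) (I : choiceType) (J : finType) (P : pred J)
    (u : ell2 R I) (F : J -> ell2 R I) :
  complex.Re (inner u (\sum_(j | P j) F j)) =
    \sum_(j | P j) complex.Re (inner u (F j)).
Proof.
elim/big_rec2: _ => [|j x y _ <-]; last by rewrite Re_innerD.
rewrite /inner /csum /= -[RHS](rsum0 R I); congr rsum; apply/funext => i.
by rewrite mulr0.
Qed.

Lemma Re_inner_self (R : realType) (I : choiceType) (u : ell2 R I) :
  complex.Re (inner u u) = fine (\esum_(i in [set: I]) (cabs (u i) ^+ 2)%:E).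
Proof.
have E i : complex.Re ((u i)^* * u i) = cabs (u i) ^+ 2.
  by case: (u i) => a b; rewrite /cabs normc_def /= sqr_sqrtr ?addr_ge0 ?sqr_ge0//; ring.
rewrite /inner /csum /= rsum_ge0E => [|i]; last by rewrite E sqr_ge0.
by congr fine; apply: eq_esum => i _; rewrite E.
Qed.

(** * Product vectors and outcome probabilities *)

Lemma esumZl (R : realType) (I : choiceType) (c s : R) (g : I -> R) :
  0 <= c -> (forall i, 0 <= g i) ->
  (\esum_(i in [set: I]) (g i)%:E = s%:E)%E ->
  (\esum_(i in [set: I]) (c * g i)%:E = (c * s)%:E)%E.
Proof.
have le (d : R) (h : I -> R) : 0 <= d -> (forall i, 0 <= h i) ->
    (\esum_(i in [set: I]) (d * h i)%:E <= d%:E * \esum_(i in [set: I]) (h i)%:E)%E.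
  move=> d0 h0; apply: ge_ereal_sup => _ [/= F [finF _] <-].
  under eq_fsbigr do rewrite EFinM.
  rewrite -ge0_mule_fsumr; last by move=> i; rewrite lee_fin.
  rewrite lee_pmul ?lee_fin//; first by apply: fsume_ge0 => i _; rewrite lee_fin.
  by apply: ereal_sup_ubound; exists F.
move=> c0 g0 gs; apply/eqP; rewrite eq_le EFinM -{1}gs le//=.
have [->|cn0] := eqVneq c 0.
  by rewrite mul0e; apply: esum_ge0 => i _; rewrite mul0r.
have cp : 0 < c by rewrite lt_neqAle eq_sym cn0.
(* The reverse inequality is the same bound, applied to the scaled family with the factor [c^-1]. *)
have := le c^-1 (fun i => c * g i).
rewrite invr_ge0 => /(_ c0) /(_ (fun i => mulr_ge0 c0 (g0 i))).
under eq_esum do rewrite mulKf//.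
rewrite gs => H; rewrite -lee_pdivlMl//.
Qed.

(** A product of [n] infinite sums expands into one sum over [n]-tuples, by induction: the first
    coordinate is split off and the double sum is evaluated from the inside. *)
Lemma esum_prod (R : realType) (I : choiceType) (n : nat) (f : 'I_n -> I -> R)
    (s : 'I_n -> R) :
  (forall i x, 0 <= f i x) ->
  (forall i, (\esum_(x in [set: I]) (f i x)%:E = (s i)%:E)%E) ->
  (\esum_(k in [set: {ffun 'I_n -> I}]) (\prod_i f i (k i))%:E =
   (\prod_i s i)%:E)%E.
Proof.
elim: n f s => [|n IH] f s f0 fs.
  rewrite big_ord0 (_ : [set: _] = [set ffun0 (card_ord 0)]).
    by rewrite esum_set1 big_ord0.
  by apply/seteqP; split => // k _ /=; apply/ffunP => -[].
pose e (k : I * {ffun 'I_n -> I}) : {ffun 'I_n.+1 -> I} :=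
  [ffun i => oapp k.2 k.1 (unlift ord0 i)].
have e0 k : e k ord0 = k.1 by rewrite ffunE unlift_none.
have eS k i : e k (lift ord0 i) = k.2 i by rewrite ffunE liftK.
rewrite (reindex_esum ([set: I] `*`` (fun=> [set: {ffun 'I_n -> I}])) _ e); last first.
  split => //.
    move=> [a k] [b l] _ _ H.
    have := congr1 (fun h : {ffun _ -> _} => h ord0) H; rewrite !e0 /= => ->.
    congr pair; apply/ffunP => i.
    by have := congr1 (fun h : {ffun _ -> _} => h (lift ord0 i)) H; rewrite !eS.
  move=> h _ /=; exists (h ord0, [ffun i => h (lift ord0 i)]) => //.
  apply/ffunP => i; case: (unliftP ord0 i) => [j|] ->; first by rewrite eS ffunE.
  by rewrite e0.
rewrite -(esum_esum (a := fun x k => (\prod_i f i (e (x, k) i))%:E)); last first.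
  by move=> *; rewrite lee_fin prodr_ge0.
pose S := \prod_(i < n) s (lift ord0 i).
have inner_sum x :
    (\esum_(k in [set: {ffun 'I_n -> I}]) (\prod_i f i (e (x, k) i))%:E =
     (S * f ord0 x)%:E)%E.
  rewrite mulrC -(@esumZl _ {ffun 'I_n -> I} _ _ (fun k => \prod_i f (lift ord0 i) (k i)))//.
  - apply: eq_esum => k _; rewrite big_ord_recl e0.
    by congr (_ * _)%:E; apply: eq_bigr => i _; rewrite eS.
  - by move=> k; rewrite prodr_ge0.
  - exact: (IH (fun i => f (lift ord0 i)) (fun i => s (lift ord0 i))).
under eq_esum do rewrite inner_sum.
rewrite big_ord_recl mulrC; apply: esumZl => //; apply: prodr_ge0 => i _.
by rewrite -lee_fin -fs; apply: esum_ge0 => x _; rewrite lee_fin.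
Qed.

Definition product_fun (R : realType) (n : nat) (psi : 'I_n -> fock R)
  (k : modes n) : R[i] := \prod_i psi i (k i).

Lemma cabs_prod (R : realType) (n : nat) (f : 'I_n -> R[i]) :
  cabs (\prod_i f i) = \prod_i cabs (f i).
Proof.
elim/big_rec2: _ => [|i x y _ <-]; first by rewrite cabs1.
by rewrite cabsM.
Qed.

(** Normalization is stated as an unordered sum rather than through [inner], so that [esum_prod]
    applies to product vectors directly. *)
Definition unit_vec (R : realType) (I : choiceType) (u : ell2 R I) :=
  (\esum_(i in [set: I]) (cabs (u i) ^+ 2)%:E = 1)%E.

Lemma esum_product_fun (R : realType) (n : nat) (psi : 'I_n -> fock R) :
  (forall i, unit_vec (psi i)) ->
  (\esum_(k in [set: modes n]) (cabs (product_fun psi k) ^+ 2)%:E = 1)%E.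
Proof.
move=> psi1.
have := @esum_prod R nat n (fun i x => cabs (psi i x) ^+ 2) (fun=> 1).
rewrite prodr_const expr1n => <- //; last by move=> i x; exact: sqr_ge0.
by apply: eq_esum => k _; rewrite cabs_prod prodrXl.
Qed.

Lemma product_ell2 (R : realType) (n : nat) (psi : 'I_n -> fock R) :
  (forall i, unit_vec (psi i)) -> product_fun psi \in @ell2_pred R (modes n).
Proof. by move=> psi1; apply/asboolP; rewrite esum_product_fun// ltry. Qed.

Definition product_vec (R : realType) (n : nat) (psi : 'I_n -> fock R)
  (psi1 : forall i, unit_vec (psi i)) : ell2 R (modes n) :=
  Ell2 (product_ell2 psi1).

(** A tensor product of rank-one projections is the rank-one projection on the product vector. Basis
    vectors suffice, since the trace evaluates the operator only on them. *)
Lemma tensor_ketbra_basis (R : realType) (n : nat) (psi : 'I_n -> fock R)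
    (psi1 : forall i, unit_vec (psi i)) (l : modes n) :
  tensor_op (fun i => ketbra (psi i) (psi i)) (basis_vec R l) =
    (product_vec psi1 l)^* *: product_vec psi1.
Proof.
rewrite /tensor_op /op_of_mx.
set u := (X in insubd 0 X).
set v : ell2 R (modes n) := (_ *: _).
(* The image is a multiple of [product_vec], hence square-summable, and the default value of
   [insubd] does not occur. *)
suff -> : u = \val v by rewrite valKd.
apply/funext => k; rewrite [RHS]ell2_scale /u (csum_single (k := l)) /=;
  last by move=> i /negPf->; rewrite mulr0.
rewrite eqxx mulr1 [RHS]mulrC /product_fun rmorph_prod -big_split /=.
apply: eq_bigr => i _; rewrite /mx_of_op inner_basis_vec /ketbra ell2_scale.
by rewrite inner_basis_vecr mulrC.
Qed.

(** The diagonal entry of the trace at [k] is the conjugate of [psi k] times [(E m psi) k], which is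
    already the summand of the inner product; no sums are interchanged. *)
Lemma outcome_prob_product (R : realType) (M : finType) (n : nat)
    (E : povm R M (modes n)) (psi : 'I_n -> fock R)
    (psi1 : forall i, unit_vec (psi i)) (m : M) :
  outcome_prob E (tensor_op (fun i => ketbra (psi i) (psi i))) m =
    complex.Re (inner (product_vec psi1) (E m (product_vec psi1))).
Proof.
rewrite /outcome_prob /trace /inner; congr (complex.Re (csum _)).
apply/funext => k; rewrite /mx_of_op /= inner_basis_vec tensor_ketbra_basis.
by rewrite linearZ.
Qed.

Lemma outcome_prob_ge0 (R : realType) (M : finType) (n : nat)
    (E : povm R M (modes n)) (psi : 'I_n -> fock R)
    (psi1 : forall i, unit_vec (psi i)) (m : M) :
  0 <= outcome_prob E (tensor_op (fun i => ketbra (psi i) (psi i))) m.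
Proof.
rewrite (outcome_prob_product _ psi1).
by have := povm_ge0 E m (product_vec psi1); rewrite lecE => /andP[].
Qed.

Lemma sum_outcome_prob (R : realType) (M : finType) (n : nat)
    (E : povm R M (modes n)) (psi : 'I_n -> fock R)
    (psi1 : forall i, unit_vec (psi i)) :
  \sum_m outcome_prob E (tensor_op (fun i => ketbra (psi i) (psi i))) m = 1.
Proof.
under eq_bigr do rewrite (outcome_prob_product _ psi1).
by rewrite -Re_inner_sum povm_sum Re_inner_self esum_product_fun.
Qed.

(** The photon number of a coherent state is Poisson distributed with mean [|beta|^2]. *)
Lemma cabs_coherent_sqr (R : realType) (beta : R[i]) (m : nat) :
  cabs (coherent beta m) ^+ 2 =
    expR (- cabs beta ^+ 2) * exp_coeff (cabs beta ^+ 2) m.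
Proof.
rewrite /= /coherent_fun !cabsM -fmorphV !cabsR cabsX !exprMn.
rewrite (ger0_norm (expR_ge0 _)) ger0_norm ?invr_ge0 ?sqrtr_ge0//.
rewrite exprVn sqr_sqrtr// /exp_coeff /= -!exprM mulnC; congr (_ * _).
by rewrite -expRM_natl; congr expR; field.
Qed.

Lemma coherent_unit (R : realType) (beta : R[i]) : unit_vec (coherent beta).
Proof.
have x0 : 0 <= cabs beta ^+ 2 by rewrite sqr_ge0.
rewrite /unit_vec; under eq_esum do rewrite cabs_coherent_sqr.
rewrite (@esumZl _ _ _ (expR (cabs beta ^+ 2))) ?expR_ge0//.
- by rewrite -expRD addNr expR0.
- by move=> m; rewrite exp_coeff_ge0.
rewrite -nneseries_esumT; last by move=> m; rewrite lee_fin exp_coeff_ge0.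
rewrite /expR -EFin_lim; last exact: is_cvg_series_exp_coeff.
by congr (limn _); apply/funext => n /=; rewrite sumEFin.
Qed.

(** * Converse *)

Lemma card_F2_rV (l : nat) : #|{: 'rV['F_2]_l}| = (2 ^ l)%N.
Proof. by rewrite card_mx mul1n card_Fp. Qed.

Lemma mac_prob_ge0 (R : realType) (alpha : R[i]) (M : finType) (n : nat)
    (E : povm R M (modes n)) (a b : 'rV['F_2]_n) (m : M) :
  0 <= outcome_prob E (mac_output (coherent_mac alpha) a b) m.
Proof.
exact: (@outcome_prob_ge0 R M n E
  (fun i => coherent (((-1) ^+ a 0 i + (-1) ^+ b 0 i) * alpha))
  (fun i => coherent_unit _)).
Qed.

Lemma sum_mac_prob (R : realType) (alpha : R[i]) (M : finType) (n : nat)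
    (E : povm R M (modes n)) (a b : 'rV['F_2]_n) :
  \sum_m outcome_prob E (mac_output (coherent_mac alpha) a b) m = 1.
Proof.
exact: (@sum_outcome_prob R M n E
  (fun i => coherent (((-1) ^+ a 0 i + (-1) ^+ b 0 i) * alpha))
  (fun i => coherent_unit _)).
Qed.

(* Messages sharing an input are told apart by disjoint decoding events. *)
Lemma sum_success_le (R : realType) (X M : finType) (Q : X -> M -> R)
    (e : M -> X) (h : M -> M) :
  (forall x m, 0 <= Q x m) -> (forall x, \sum_m Q x m = 1) -> injective h ->
  \sum_m Q (e m) (h m) <= #|X|%:R.
Proof.
move=> Q0 Q1 hinj; rewrite (partition_big e xpredT)//=.
rewrite -sum1_card natr_sum; apply: ler_sum => x _.
have -> : 1%:R = \sum_m Q x (h m) by rewrite -(Q1 x); exact: reindex_inj.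
rewrite [leRHS](bigID (fun m => e m == x))/= ler_wpDr ?sumr_ge0//.
by rewrite le_eqVlt; apply/orP; left; apply/eqP/eq_bigr => m /eqP ->.
Qed.

Lemma comp_error_ge (R : realType) (alpha : R[i]) (n l : nat)
    (c : comp_code R n l) :
  1 - 2 ^+ n / 2 ^+ l <= comp_error (coherent_mac alpha) c.
Proof.
pose Q x mB m := outcome_prob (decoder c)
  (mac_output (coherent_mac alpha) x (encB c mB)) m.
have QE x mB m0 : \sum_(m | m != m0) Q x mB m = 1 - Q x mB m0.
  rewrite -(sum_mac_prob alpha (decoder c) x (encB c mB)) [X in _ = X - _](bigD1 m0)//=.
  by rewrite /Q addrAC subrr add0r.
have succ mB : \sum_mA Q (encA c mA) mB (mA + mB) <= 2 ^+ n.
  rewrite -natrX -card_F2_rV.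
  apply: (sum_success_le (Q := fun x m => Q x mB m)) => [x m|x|].
  - exact: mac_prob_ge0.
  - exact: sum_mac_prob.
  - exact: addIr.
have N0 : 0 < (2 ^+ l : R) by rewrite exprn_gt0.
rewrite /comp_error card_F2_rV natrX.
rewrite (eq_bigr (fun mA => \sum_mB (1 - Q (encA c mA) mB (mA + mB)))); last first.
  by move=> mA _; apply: eq_bigr => mB _; exact: QE.
(* With [mB] outermost, [succ] bounds the inner sum: at most [2^n] of the [2^l] messages [mA] are
   decoded correctly, counted with probability. *)
rewrite exchange_big /=.
rewrite -(ler_pM2l (exprn_gt0 2 N0)) mulVKf; last by rewrite expf_neq0// gt_eqF.
rewrite (_ : (2 ^+ l) ^+ 2 * _ = \sum_(mB : 'rV['F_2]_l) (2 ^+ l - 2 ^+ n)); last first.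
  rewrite sumr_const card_F2_rV -[RHS]mulr_natl natrX.
  by field; rewrite gt_eqF.
apply: ler_sum => mB _; rewrite sumrB sumr_const card_F2_rV natrX lerB//.
Qed.

Lemma comp_achievable_le (R : realType) (base : R) (alpha : R[i]) (r : R) :
  1 < base -> comp_achievable base (coherent_mac alpha) r -> r <= logb base 2.
Proof.
move=> hbase [l [c [lr err]]].
have L0 : 0 <= logb base 2 by rewrite /logb divr_ge0 ?ln_ge0 ?ler1n// ltW.
have small : \forall n \near \oo, comp_error (coherent_mac alpha) (c n) < 2^-1.
  by apply: cvgr_lt err _ _; rewrite invr_gt0.
apply: (ler_cvg_to lr (cvg_cst (logb base 2))).
near=> n; rewrite ler_piMl//.
have ln : (l n <= n)%N.
  rewrite leqNgt; apply/negP => nl.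
  have : comp_error (coherent_mac alpha) (c n) < 2^-1 by near: n.
  apply/negP; rewrite -leNgt; apply: le_trans (comp_error_ge alpha (c n)).
  (* If [l n > n], then [2^n / 2^(l n)] is at most 1/2, and so the error is at least 1/2. *)
  rewrite lerBrDr -lerBrDl [leRHS](_ : _ = 2^-1); last by field.
  rewrite ler_pdivrMr ?exprn_gt0// -(subnKC nl) exprD exprS -mulrA mulKf//.
  by rewrite ler_peMr ?exprn_ge0// exprn_ege1// ler1n.
(* At [n = 0] the quotient is 0 by the convention on inverses. *)
have [->|n0] := posnP n; first by rewrite invr0 mulr0.
by rewrite ler_pdivrMr ?ltr0n// mul1r ler_nat.
Unshelve. all: by end_near. Qed.

Lemma comp_rate_le (R : realType) (base : R) (alpha : R[i]) :
  1 < base -> (comp_rate base (coherent_mac alpha) <= (logb base 2)%:E)%E.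
Proof.
move=> hbase; apply: ge_ereal_sup => _ [r ach <-].
by rewrite lee_fin; exact: comp_achievable_le ach.
Qed.

(** * Linear codes with large minimum distance *)

Definition supp (n : nat) (v : 'rV['F_2]_n) : {set 'I_n} :=
  [set i | v 0 i != 0].

Definition wt (n : nat) (v : 'rV['F_2]_n) : nat := #|supp v|.

Definition hball (n w : nat) : {set 'rV['F_2]_n} := [set v | (wt v <= w)%N].

Lemma F2_neq0 (x : 'F_2) : x != 0 -> x = 1.
Proof. by case: x => -[|[|//]] // h _; apply: val_inj. Qed.

Lemma F2_opp (x : 'F_2) : - x = x.
Proof. by case: x => -[|[|//]] // h; apply: val_inj. Qed.

Lemma supp_inj (n : nat) : injective (@supp n).
Proof.
move=> u v /setP uv; apply/rowP => i; have := uv i; rewrite !inE.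
have [->|/F2_neq0->] := eqVneq (u 0 i) 0; have [->|/F2_neq0->] := eqVneq (v 0 i) 0 => //.
Qed.

Lemma wtD (n : nat) (u v : 'rV['F_2]_n) : (wt (u + v) <= wt u + wt v)%N.
Proof.
apply: leq_trans (leq_card_setU _ _).1; apply/subset_leq_card.
apply/fintype.subsetP => i; rewrite !inE mxE -negb_and; apply: contra.
by case/andP => /eqP-> /eqP->; rewrite addr0.
Qed.

(* Gilbert-Varshamov: a new row can be chosen outside all translates of the
   ball of radius [w] by the codewords obtained so far. *)
Lemma linear_code_exists (n w l : nat) :
  (forall j, (j < l)%N -> (2 ^ j * #|hball n w| < 2 ^ n)%N) ->
  exists G : 'M['F_2]_(l, n), forall d, d != 0 -> (w < wt (d *m G))%N.
Proof.
elim: l => [|l IH] hl.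
  by exists 0 => d; rewrite thinmx0 eqxx.
have [|G hG] := IH; first by move=> j jl; apply: hl; rewrite ltnS ltnW.
pose C := [set x.1 *m G + x.2 | x in finset.setX [set: 'rV['F_2]_l] (hball n w)]%SET.
have /existsP[v vC] : [exists v, v \notin C].
  apply/existsPn => H; have := hl l (ltnSn l); apply/negP; rewrite -leqNgt.
  rewrite -(card_F2_rV n) -(card_F2_rV l) -[X in (_ <= X * _)%N]cardsT -cardsX.
  apply: leq_trans (leq_imset_card (fun x => x.1 *m G + x.2) _).
  by apply: subset_leq_card; apply/fintype.subsetP => v _; have := H v; rewrite negbK.
exists (col_mx v G : 'M['F_2]_(1 + l, n)) => d.
change 'rV['F_2]_(1 + l) in d; change (d != 0 -> (w < wt (d *m col_mx v G))%N).
rewrite -[d]hsubmxK; move: (lsubmx d) (rsubmx d) => a c d0.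
(* If the coefficient [a] of the new row is 0, the induction hypothesis applies. Otherwise it is 1,
   and a light codeword [v + c *m G] would put [v] in the translate of the ball by [- c *m G]. *)
rewrite mul_row_col; have [a0|a0] := eqVneq (a 0 0) 0.
  have {}a0 : a = 0 by apply/matrixP => i j; rewrite !ord1 a0 mxE.
  rewrite a0 mul0mx add0r; apply: hG; apply: contra_neq d0 => ->.
  by rewrite a0 row_mx0.
have {}a0 : a = 1%:M.
  by apply/matrixP => i j; rewrite !ord1 (F2_neq0 a0) mxE.
rewrite a0 mul1mx ltnNge; apply: contra vC => vcw.
apply/imsetP; exists (- c, v + c *m G); first by rewrite !inE.
by rewrite /= mulNmx addrCA addNr addr0.
Qed.

(** Chernoff-type count: [(1 + K^-1)^n] is the sum of [K^-|S|] over all subsets [S], and each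
    support of size at most [w] contributes at least [K^-w]. *)
Lemma hball_card_le (R : realType) (n w : nat) (K : R) : 1 <= K ->
  #|hball n w|%:R <= K ^+ w * (1 + K^-1) ^+ n.
Proof.
move=> K1; have K0 : 0 < K by exact: lt_le_trans K1.
have sumE : (1 + K^-1) ^+ n = \sum_(S : {set 'I_n}) K^-1 ^+ #|S|.
  transitivity (\prod_(i < n) (K^-1 + 1)).
    by rewrite prodr_const card_ord addrC.
  rewrite bigA_distr; apply: eq_big => // S _.
  by rewrite -big_mkcond prodr_const.
rewrite sumE mulr_sumr -sum1_card natr_sum.
apply: (@le_trans _ _ (\sum_(S in [set supp v | v in hball n w]%SET) K ^+ w * K^-1 ^+ #|S|)).
  rewrite big_imset /=; last by move=> u v _ _; exact: supp_inj.
  apply: ler_sum => v; rewrite inE => vw.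
  by rewrite exprVn ler_pdivlMr ?exprn_gt0// mul1r ler_weXn2l.
rewrite [leRHS](bigID (mem [set supp v | v in hball n w]%SET))/= lerDl.
by apply: sumr_ge0 => S _; rewrite mulr_ge0// exprn_ge0// ?invr_ge0 ltW.
Qed.

(** * Measurements in the number basis *)

Lemma mask_ell2 (R : realType) (I : choiceType) (P : pred I) (u : ell2 R I) :
  (fun i => if P i then u i else 0) \in @ell2_pred R I.
Proof.
have /asboolP ufin := ell2_funP u; apply/asboolP.
apply: le_esum_lty ufin => i; case: ifP => // _.
by rewrite cabs0 expr0n sqr_ge0.
Qed.

(** The orthogonal projection onto the closed span of the basis vectors selected by [P]. *)
Definition mask (R : realType) (I : choiceType) (P : pred I) (u : ell2 R I) :
  ell2 R I := Ell2 (mask_ell2 P u).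

Lemma mask_is_linear (R : realType) (I : choiceType) (P : pred I) :
  linear (@mask R I P).
Proof.
move=> a u v; apply: val_inj; apply/funext => i /=.
rewrite -[LHS]/(if P i then a * u i + v i else 0).
rewrite -[RHS]/(a * (if P i then u i else 0) + (if P i then v i else 0)).
by case: ifP => // _; rewrite mulr0 addr0.
Qed.

HB.instance Definition _ (R : realType) (I : choiceType) (P : pred I) :=
  GRing.isLinear.Build R[i] (ell2 R I) (ell2 R I) _ (@mask R I P)
    (@mask_is_linear R I P).

Lemma inner_self (R : realType) (I : choiceType) (u : ell2 R I) :
  inner u u = (fine (\esum_(i in [set: I]) (cabs (u i) ^+ 2)%:E))%:C.
Proof.
rewrite -Re_inner_self /inner /csum /=; congr (_ +i* _).
rewrite -[RHS](rsum0 R I); congr rsum; apply/funext => i.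
by case: (u i) => a b /=; ring.
Qed.

Lemma inner_mask (R : realType) (I : choiceType) (P : pred I) (u : ell2 R I) :
  inner u (mask P u) = inner (mask P u) (mask P u).
Proof.
rewrite /inner; congr csum; apply/funext => i /=.
by case: ifP => // _; rewrite !mulr0.
Qed.

Lemma esum_sqr_fin (R : realType) (I : choiceType) (u : ell2 R I) :
  (\esum_(i in [set: I]) (cabs (u i) ^+ 2)%:E)%E \is a fin_num.
Proof.
have /asboolP ufin := ell2_funP u.
by rewrite ge0_fin_numE//; apply: esum_ge0 => i _; rewrite lee_fin sqr_ge0.
Qed.

Lemma esum_sqr_ge0 (R : realType) (I : choiceType) (u : ell2 R I) :
  0 <= fine (\esum_(i in [set: I]) (cabs (u i) ^+ 2)%:E).
Proof.
by rewrite fine_ge0//; apply: esum_ge0 => i _; rewrite lee_fin sqr_ge0.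
Qed.

Lemma mask_bounded (R : realType) (I : choiceType) (P : pred I) :
  exists c : R, forall u : ell2 R I,
    cabs (inner (mask P u) (mask P u)) <= c * cabs (inner u u).
Proof.
exists 1 => u; rewrite mul1r !inner_self !cabsR !ger0_norm ?esum_sqr_ge0//.
rewrite fine_le ?esum_sqr_fin//; apply: le_esum => i _; rewrite lee_fin /=.
by case: ifP => // _; rewrite cabs0 expr0n sqr_ge0.
Qed.

Lemma mask_ge0 (R : realType) (I : choiceType) (P : pred I) (u : ell2 R I) :
  0 <= inner u (mask P u).
Proof. by rewrite inner_mask inner_self lecR esum_sqr_ge0. Qed.

(** The case of a general [Q] turns the whole error event into a single projection; [Q = predT]
    gives completeness of the measurement. *)
Lemma sum_mask (R : realType) (I : choiceType) (M : finType) (dec : I -> M)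
    (Q : pred M) (u : ell2 R I) :
  \sum_(m | Q m) mask (fun i => dec i == m) u = mask (fun i => Q (dec i)) u.
Proof.
apply: val_inj; apply/funext => i; rewrite [LHS]ell2_sum /=.
rewrite -big_mkcondr /=; case: ifP => Qi; last first.
  by rewrite big_pred0// => m; case: eqVneq => [<-|]; rewrite ?Qi ?andbF.
rewrite (big_pred1 (dec i))// => m /=.
by rewrite [dec i == m]eq_sym; case: (eqVneq m) => [->|]; rewrite ?Qi ?andbF.
Qed.

Lemma sum_mask_total (R : realType) (I : choiceType) (M : finType) (dec : I -> M)
    (u : ell2 R I) : \sum_m mask (fun i => dec i == m) u = u.
Proof. by rewrite (sum_mask dec predT); apply: val_inj; apply/funext. Qed.

Definition number_povm (R : realType) (I : choiceType) (M : finType)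
  (dec : I -> M) : povm R M I :=
  @Povm R M I (fun m => mask (fun i => dec i == m))
    (fun m => mask_bounded R (fun i => dec i == m))
    (fun m => mask_ge0 (fun i => dec i == m))
    (sum_mask_total dec).

(** The error probability is the mass of the product distribution on the wrongly decoded [k], so a
    dominating [g] with a computable sum bounds it. *)
Lemma number_povm_error_le (R : realType) (M : finType) (n : nat)
    (dec : modes n -> M) (psi : 'I_n -> fock R)
    (psi1 : forall i, unit_vec (psi i)) (m0 : M) (g : modes n -> R) (s : R) :
  (forall k, 0 <= g k) ->
  (forall k, dec k != m0 -> \prod_i cabs (psi i (k i)) ^+ 2 <= g k) ->
  (\esum_(k in [set: modes n]) (g k)%:E = s%:E)%E ->
  \sum_(m | m != m0)
    outcome_prob (number_povm R dec) (tensor_op (fun i => ketbra (psi i) (psi i))) m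
  <= s.
Proof.
move=> g0 gP gs.
under eq_bigr do rewrite (outcome_prob_product _ psi1).
rewrite -Re_inner_sum (sum_mask dec (fun m => m != m0)) inner_mask Re_inner_self.
rewrite -[s]/(fine s%:E) -gs fine_le ?esum_sqr_fin ?gs//.
rewrite -gs; apply: le_esum => k _; rewrite lee_fin /=.
case: ifP => [dk|_]; last by rewrite cabs0 expr0n.
by rewrite cabs_prod -prodrXl gP.
Qed.

(** * Error probability of a linear code *)

(** Bounded-distance decoding: any message whose codeword is within distance [t] of [y], with
    default 0 if there is none. Over [F_2] the sum [y + m *m G] is the difference. *)
Definition decode (l n t : nat) (G : 'M['F_2]_(l, n)) (y : 'rV['F_2]_n) :
  'rV['F_2]_l := odflt 0 [pick m | (wt (y + m *m G) <= t)%N].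

Lemma F2_rV_opp (n : nat) (u : 'rV['F_2]_n) : - u = u.
Proof. by apply/rowP => i; rewrite mxE F2_opp. Qed.

Lemma decode_correct (l n t : nat) (G : 'M['F_2]_(l, n)) (y : 'rV['F_2]_n)
    (m : 'rV['F_2]_l) :
  (forall d, d != 0 -> (t + t < wt (d *m G))%N) ->
  (wt (y + m *m G) <= t)%N -> decode t G y = m.
Proof.
move=> dist ym; rewrite /decode; case: pickP => [m' /= ym'|/(_ m)]; last first.
  by rewrite ym.
apply/eqP; rewrite -subr_eq0; apply/negPn/negP => /dist.
(* Two codewords within distance [t] of [y] are at distance at most [2t], contrary to [dist]. *)
rewrite ltnNge => /negP; apply; apply: leq_trans (leq_add ym' ym).
apply: leq_trans (wtD _ _); rewrite addrACA -[y in X in (_ <= wt (_ + X + _))%N]F2_rV_opp.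
by rewrite subrr add0r -mulmxDl -[m in leqRHS]F2_rV_opp.
Qed.

Definition vacuum_bits (n : nat) (k : modes n) : 'rV['F_2]_n :=
  \row_i (k i == 0%N)%:R.

Lemma vacuum_bitsD (n : nat) (k : modes n) (u v : 'rV['F_2]_n) i :
  (vacuum_bits k + (u + v)) 0 i = (k i == 0%N)%:R + (u 0 i + v 0 i).
Proof. by rewrite !mxE. Qed.

Lemma mac_amplitude (R : realType) (alpha : R[i]) (a b : 'F_2) :
  cabs (((-1) ^+ a + (-1) ^+ b) * alpha) ^+ 2 =
    (if a + b == 0 then 4 * cabs alpha ^+ 2 else 0).
Proof.
have two : cabs (2%:R : R[i]) = 2.
  by rewrite -(rmorph_nat (real_complex R)) cabsR ger0_norm.
rewrite cabsM exprMn.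
case: a => -[|[|//]] ha; case: b => -[|[|//]] hb; rewrite /= ?expr0 ?expr1.
- by rewrite -[1 + 1]/(2%:R : R[i]) two; ring.
- by rewrite subrr cabs0 expr0n mul0r.
- by rewrite addNr cabs0 expr0n mul0r.
- rewrite -opprD -[1 + 1]/(2%:R : R[i]) -mulN1r cabsM two.
  by rewrite -[-1]/(- 1%:R) -(rmorph1 (real_complex R)) -rmorphN cabsR normrN1; ring.
Qed.

(* The bit read off a mode is wrong only if the vacuum is detected although
   a = b, which has probability exp(-4|alpha|^2). Adding [j = 0] to p keeps the
   total mass bounded (by 2) while providing this factor at each wrong bit. *)
Lemma mode_prob_le (R : realType) (alpha : R[i]) (a b : 'F_2) (j : nat) (p : R) :
  p = cabs (coherent (((-1) ^+ a + (-1) ^+ b) * alpha) j) ^+ 2 ->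
  p <= expR (- (4 * cabs alpha ^+ 2)) ^+ ((j == 0%N)%:R + (a + b) != 0 :> 'F_2) *
       (p + (j == 0%N)%:R).
Proof.
move=> pE; have p0 : 0 <= p by rewrite pE sqr_ge0.
have [E|E] := eqVneq ((j == 0%N)%:R + (a + b) : 'F_2) 0.
  by rewrite expr0 mul1r lerDl ler0n.
(* The bit is wrong here. If [a + b = 1], a photon was counted in the vacuum state, which has
   probability 0; otherwise the vacuum was detected, with probability exactly [exp(-4|alpha|^2)]. *)
rewrite expr1; have [ab|/F2_neq0 ab] := eqVneq (a + b) 0; last first.
  have j0 : (j == 0%N) = false.
    by apply: contraNF E => ->; rewrite ab; apply/eqP/val_inj.
  rewrite j0 addr0 [in leLHS]pE cabs_coherent_sqr mac_amplitude ab /=.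
  by rewrite /exp_coeff /= expr0n j0 mul0r mulr0 mulr_ge0// expR_ge0.
have j0 : j = 0%N by apply/eqP; apply: contraNT E => /negPf->; rewrite ab addr0.
rewrite j0 eqxx mulrDr mulr1 ler_wpDl ?mulr_ge0 ?expR_ge0//.
rewrite pE j0 cabs_coherent_sqr mac_amplitude ab eqxx.
by rewrite /exp_coeff /= expr0 fact0 invr1 !mulr1.
Qed.

Definition linear_code (R : realType) (l n t : nat) (G : 'M['F_2]_(l, n)) :
  comp_code R n l :=
  CompCode (fun m => m *m G) (fun m => m *m G)
    (number_povm R (fun k => decode t G (vacuum_bits k))).

Lemma linear_code_error_le (R : realType) (alpha : R[i]) (l n t : nat)
    (G : 'M['F_2]_(l, n)) :
  (forall d, d != 0 -> (t + t < wt (d *m G))%N) ->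
  comp_error (coherent_mac alpha) (linear_code R t G) <=
    expR (- (4 * cabs alpha ^+ 2)) ^+ t * 2 ^+ n.
Proof.
move=> dist; set eps := expR _; set c := linear_code _ _ _.
have eps0 : 0 <= eps by exact: expR_ge0.
have eps1 : eps <= 1.
  by rewrite -expR0 ler_expR oppr_le0 mulr_ge0// sqr_ge0.
(* The bound is uniform in the messages, so it passes to their average. *)
suff err mA mB : \sum_(m | m != mA + mB) outcome_prob (decoder c)
    (mac_output (coherent_mac alpha) (encA c mA) (encB c mB)) m
    <= eps ^+ t * 2 ^+ n.
  rewrite /comp_error ler_pdivrMl; last first.
    by rewrite exprn_gt0// ltr0n card_F2_rV expn_gt0.
  rewrite mulrC expr2 mulrA !mulr_natr -!sumr_const.
  by apply: ler_sum => mA _; rewrite sumr_const -sumr_const; apply: ler_sum.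
pose a : 'rV['F_2]_n := mA *m G; pose b : 'rV['F_2]_n := mB *m G.
pose psi i := coherent (((-1) ^+ a 0 i + (-1) ^+ b 0 i) * alpha).
pose p i j := cabs (psi i j) ^+ 2.
pose q i j := p i j + (j == 0%N)%:R.
have p0 i j : 0 <= p i j by exact: sqr_ge0.
have q0 i j : 0 <= q i j by rewrite addr_ge0.
(* Each mode has mass 1 from [p] and 1 from the added indicator; the [n] modes together produce the
   factor [2^n]. *)
have sumq i : (\esum_(j in [set: nat]) (q i j)%:E = 2%:E)%E.
  under eq_esum do rewrite EFinD.
  rewrite esumD => [|j _|j _]; rewrite ?lee_fin// coherent_unit.
  rewrite (esumID [set 0%N]) => [|j _]; rewrite ?lee_fin//.
  rewrite setTI esum_set1// esum1 ?adde0// => j [_ /eqP/negPf /= ->]//.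
apply: (@number_povm_error_le _ _ _ _ psi (fun i => coherent_unit _) _
  (fun k => eps ^+ t * \prod_i q i (k i))).
- by move=> k; rewrite mulr_ge0 ?exprn_ge0// prodr_ge0.
- move=> k dk.
  (* A decoding error requires more than [t] wrong bits, each of which costs a factor [eps]. *)
  have flips : (t < wt (vacuum_bits k + (mA + mB) *m G))%N.
    by rewrite ltnNge; apply: contra dk => /(decode_correct dist)->.
  apply: (@le_trans _ _ (eps ^+ wt (vacuum_bits k + (mA + mB) *m G) *
                         \prod_i q i (k i))); last first.
    rewrite ler_wpM2r ?prodr_ge0//.
    by rewrite ler_wiXn2l// ltnW.
  (* The power of [eps] is spread over the modes so that [mode_prob_le] applies to each of them. *)
  rewrite (_ : eps ^+ wt _ = \prod_i if i \in supp (vacuum_bits k + (mA + mB) *m G)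
    then eps else 1); last by rewrite -big_mkcond prodr_const.
  rewrite -big_split /=.
  apply: ler_prod => i _; rewrite p0 /=.
  have := @mode_prob_le R alpha (a 0 i) (b 0 i) (k i) (p i (k i)) erefl.
  rewrite inE mulmxDl vacuum_bitsD.
  by case: (_ != 0); rewrite ?expr0 ?expr1.
- apply: esumZl; first by rewrite exprn_ge0.
    by move=> k; rewrite prodr_ge0.
  have := @esum_prod R nat n q (fun=> 2) q0 sumq.
  by rewrite prodr_const card_ord.
Qed.

(** * Rates *)

(** From [exp(-1/2) >= 1 - 1/2] one gets [exp(1/2) <= 2], which is then squared. Powers of [e] can
    thus be absorbed into powers of 2. *)
Lemma expR1_le4 (R : realType) : expR 1 <= 4 :> R.
Proof.
have h : expR (2^-1) <= 2 :> R.
  have := expR_ge1Dx (- 2^-1 : R); rewrite expRN => h.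
  rewrite -[leRHS]invrK -[leLHS]invrK lef_pV2 ?posrE ?invr_gt0 ?expR_gt0//.
  by apply: le_trans h; lra.
rewrite [X in expR X](_ : _ = 2%:R * 2^-1); last by rewrite mulfV.
rewrite expRM_natl (_ : (4 : R) = 2 ^+ 2); last by ring.
by rewrite lerXn2r ?nnegrE ?expR_ge0.
Qed.

(** Take [K = 2^j] in [hball_card_le], and let [q] be the quotient of [n] by [2^j]. Then
    [K^(2t) <= 2^q] and [(1 + 2^-j)^n <= e^(n / 2^j) <= 4^(q + 1)], with total exponent
    [q + 2(q + 1)]. *)
Lemma hball_card_pow (R : realType) (j n t : nat) :
  (t * (2 * j * 2 ^ j) <= n)%N ->
  (#|hball n (t + t)| <= 2 ^ (3 * (n %/ 2 ^ j) + 2))%N.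
Proof.
set q := (n %/ 2 ^ j)%N => tn.
have K0 : (0 < 2 ^ j)%N by rewrite expn_gt0.
have tq : (j * (t + t) <= q)%N.
  by rewrite leq_divRL//; apply: leq_trans tn; rewrite addnn -mul2n; lia.
rewrite -(ler_nat R).
have K1 : 1 <= 2 ^+ j :> R by rewrite exprn_ege1// ler1n.
apply: le_trans (hball_card_le n (t + t) K1) _.
have -> : (2 ^ (3 * q + 2))%:R = 2 ^+ q * 4 ^+ q.+1 :> R.
  by rewrite natrX (_ : (4 : R) = 2 ^+ 2) -?exprM -?exprD; [congr (_ ^+ _); lia|ring].
rewrite ler_pM ?exprn_ge0 ?addr_ge0 ?invr_ge0 ?exprn_ge0//.
  by rewrite -exprM ler_weXn2l// ler1n.
apply: (@le_trans _ _ (expR (n%:R * (2 ^+ j)^-1))).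
  by rewrite expRM_natl lerXn2r ?nnegrE ?expR_ge0 ?addr_ge0 ?invr_ge0 ?exprn_ge0 ?expR_ge1Dx.
apply: (@le_trans _ _ (expR (q.+1%:R * 1))); last first.
  by rewrite expRM_natl lerXn2r ?nnegrE ?expR_ge0 ?expR1_le4.
rewrite ler_expR mulr1 ler_pdivrMr ?exprn_gt0// -natrX -natrM ler_nat.
by rewrite ltnW// ltn_ceil.
Qed.

Definition code_dim (j n : nat) : nat := (n - (3 * (n %/ 2 ^ j) + 2))%N.

(** For positive [j], the largest [t] allowed by [hball_card_pow]. *)
Definition code_radius (j n : nat) : nat := (n %/ (2 * j * 2 ^ j))%N.

Lemma good_code_exists (R : realType) (j n : nat) :
  exists G : 'M['F_2]_(code_dim j n, n), forall d, d != 0 ->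
    (code_radius j n + code_radius j n < wt (d *m G))%N.
Proof.
apply: linear_code_exists => i il.
apply: leq_ltn_trans (_ : (2 ^ (i + (3 * (n %/ 2 ^ j) + 2)) < _)%N).
  rewrite expnD leq_mul2l; apply/orP; right; apply: (@hball_card_pow R).
  exact: leq_divM.
by rewrite ltn_exp2l//; move: il; rewrite /code_dim ltn_subRL addnC.
Qed.

Lemma code_dim_rate (R : realType) (j : nat) : (2 <= j)%N ->
  (code_dim j n)%:R / n%:R @[n --> \oo] --> (1 - 3 / 2 ^+ j : R).
Proof.
move=> j2; set c : R := 1 - _.
have K0 : 0 < 2 ^+ j :> R by rewrite exprn_gt0.
have c0 : 0 <= c.
  rewrite subr_ge0 ler_pdivrMr// mul1r (@le_trans _ _ (2 ^+ 2))//.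
    by rewrite expr2; lra.
  by rewrite ler_weXn2l// ler1n.
(* Rounding in the quotient and truncation of the subtraction change the dimension by at most 2,
   which is negligible after division by [n]. *)
have bound n : `|c * n%:R - (code_dim j n)%:R| <= 2.
  pose q := (n %/ 2 ^ j)%N.
  have qle : q%:R <= n%:R / 2 ^+ j :> R.
    by rewrite ler_pdivlMr// -natrX -natrM ler_nat leq_divM.
  have qgt : n%:R / 2 ^+ j <= q%:R + 1 :> R.
    rewrite ler_pdivrMr// natr1 -natrX -natrM ler_nat ltnW// ltn_ceil//.
    by rewrite expn_gt0.
  have cE : c * n%:R = n%:R - 3 * (n%:R / 2 ^+ j) by rewrite /c; ring.
  have cn : 0 <= c * n%:R by rewrite mulr_ge0.
  rewrite /code_dim -/q; have [ln|ln] := leqP (3 * q + 2) n.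
    by rewrite natrB// natrD natrM cE ler_norml; apply/andP; split; lra.
  (* Here the subtraction truncates to 0, and [c * n] itself lies between 0 and 2; [c >= 0] comes
     from [j >= 2]. *)
  rewrite (eqP (ltnW ln)) subr0 ger0_norm// cE.
  have : n%:R <= (3 * q + 2)%:R :> R by rewrite ler_nat ltnW.
  by rewrite natrD natrM; lra.
apply/cvgrPdist_le => e e0; near=> n.
have n0 : 0 < n%:R :> R by rewrite ltr0n; near: n; exact: nbhs_infty_gt.
rewrite -(ler_pM2r n0) -[X in _ * X]ger0_norm ?(ltW n0)// -normrM mulrBl mulfVK ?gt_eqF//.
apply: (le_trans (bound n)); rewrite -ler_pdivrMl//.
by near: n; exact: nbhs_infty_ger.
Unshelve. all: by end_near. Qed.

Lemma code_radius_cvg (j : nat) : (2 <= j)%N ->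
  code_radius j n @[n --> \oo] --> \oo.
Proof.
move=> j2; apply/cvgnyPge => A; near=> n.
rewrite /code_radius leq_divRL ?muln_gt0 ?expn_gt0 ?andbT//=; last by lia.
by near: n; exact: nbhs_infty_ge.
Unshelve. all: by end_near. Qed.

(** With [T = 2 * j * 2^j] and radius [t], one has [n < (t + 1) * T]. Hence the error [eps^t * 2^n]
    is at most [2^T * (2^T * eps)^t], and the hypothesis on [alpha] makes [2^T * eps] at most
    1/2. *)
Lemma comp_achievable_coherent (R : realType) (base : R) (alpha : R[i]) (j : nat) :
  (2 <= j)%N ->
  2 ^+ (2 * j * 2 ^ j).+1 * expR (- (4 * cabs alpha ^+ 2)) <= 1 ->
  comp_achievable base (coherent_mac alpha) ((1 - 3 / 2 ^+ j) * logb base 2).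
Proof.
move=> j2; set T := (2 * j * 2 ^ j)%N; set eps := expR _ => small.
have eps0 : 0 <= eps by exact: expR_ge0.
exists (code_dim j).
exists (fun n => linear_code R (code_radius j n) (sval (cid (good_code_exists R j n)))).
split; first by apply: cvgMl; exact: code_dim_rate.
have lim0 : 2 ^+ T * (2^-1) ^+ (code_radius j n) @[n --> \oo] --> (0 : R).
  rewrite -[X in _ --> X](mulr0 (2 ^+ T)); apply: cvgMr.
  apply: (cvg_comp _ (fun t : nat => (2^-1 : R) ^+ t) (code_radius_cvg j2)).
  by apply: cvg_expr; rewrite ger0_norm ?invr_ge0// invf_lt1// ltr1n.
apply: (squeeze_cvgr _ (cvg_cst 0) lim0); near=> n; apply/andP; split.
  rewrite /comp_error mulr_ge0 ?invr_ge0 ?sqr_ge0//.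
  by do 3 (apply: sumr_ge0 => ? _); exact: mac_prob_ge0.
case: cid => G /= /linear_code_error_le.
move=> /(_ R alpha) /le_trans; apply; rewrite -/eps; set t := code_radius j n.
apply: (@le_trans _ _ (eps ^+ t * 2 ^+ (t.+1 * T))).
  rewrite ler_wpM2l ?exprn_ge0// ler_weXn2l ?ler1n// ltnW// /t /code_radius -/T.
  by rewrite ltn_ceil// !muln_gt0 expn_gt0 andbT; lia.
rewrite mulSn exprD mulrCA ler_wpM2l ?exprn_ge0// mulnC exprM -exprMn.
rewrite lerXn2r ?nnegrE ?mulr_ge0 ?exprn_ge0 ?invr_ge0//.
by move: small; rewrite exprS -mulrA; lra.
Unshelve. all: by end_near. Qed.

(** * The limit of large amplitude *)

Lemma small_vacuum_prob (R : realType) (T : nat) (alpha : R[i]) :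
  2 ^+ T < cabs alpha -> 2 ^+ T * expR (- (4 * cabs alpha ^+ 2)) <= 1.
Proof.
move=> big; rewrite expRN ler_pdivrMr ?expR_gt0// mul1r.
(* The linear bound on the exponential suffices: [1 + 4x^2 >= 4x >= x] for [x = |alpha|]. *)
apply: le_trans (expR_ge1Dx _); apply: (le_trans (ltW big)).
by have := sqr_ge0 (2 * cabs alpha - 1); nra.
Qed.

Theorem mainTheorem3 (R : realType) (base : R) (hbase : 1 < base) :
  comp_rate base (coherent_mac alpha) @[alpha --> cabs_pinfty R]
    --> (logb base 2)%:E.
Proof.
have L0 : 0 <= logb base 2 by rewrite /logb divr_ge0 ?ln_ge0 ?ler1n// ltW.
have lower j : (2 <= j)%N -> \forall alpha \near cabs_pinfty R,
    (((1 - 3 / 2 ^+ j) * logb base 2)%:E <= comp_rate base (coherent_mac alpha))%E.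
  move=> j2; exists (2 ^+ (2 * j * 2 ^ j).+1) => // alpha /= /small_vacuum_prob small.
  apply: ereal_sup_ubound; exists ((1 - 3 / 2 ^+ j) * logb base 2) => //.
  exact: comp_achievable_coherent.
(* Convergence in the extended reals needs the rate to be eventually finite; [lower] with [j = 2]
   excludes [-oo] and the converse excludes [+oo]. *)
apply/fine_cvgP; split.
  near=> alpha; rewrite fin_numElt; apply/andP; split.
    apply: (@lt_le_trans _ _ ((1 - 3 / 2 ^+ 2) * logb base 2)%:E).
      exact: ltNyr.
    by near: alpha; exact: lower.
  by apply: le_lt_trans (comp_rate_le alpha hbase) _; exact: ltry.
apply/cvgrPdist_le => e e0.
(* [j] is fixed by the tolerance [e] first; the threshold on [|alpha|] then depends on [j]. *)
have [j j2 je] : exists2 j, (2 <= j)%N & 3 / 2 ^+ j * logb base 2 <= e.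
  have lim0 : 3 / 2 ^+ j * logb base 2 @[j --> \oo] --> (0 : R).
    rewrite -[X in _ --> X](mul0r (logb base 2)); apply: cvgMl.
    rewrite -[X in _ --> X](mulr0 3); apply: cvgMr.
    under eq_fun do rewrite -exprVn.
    by apply: cvg_expr; rewrite ger0_norm ?invr_ge0// invf_lt1// ltr1n.
  have le : \forall j \near \oo, 3 / 2 ^+ j * logb base 2 <= e by apply: cvgr_le lim0 _ _.
  have ge : \forall j \near \oo, (2 <= j)%N by exact: nbhs_infty_ge.
  by have [j [? ?]] := filter_ex (filterI le ge); exists j.
near=> alpha; have up := comp_rate_le alpha hbase.
have lo : (((1 - 3 / 2 ^+ j) * logb base 2)%:E <= comp_rate base (coherent_mac alpha))%E.
  by near: alpha; exact: lower.
rewrite /=; case: (comp_rate _ _) up lo => [r| |] //=; rewrite !lee_fin => up lo.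
by rewrite ger0_norm ?subr_ge0//; lra.
Unshelve. all: by end_near. Qed.
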